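(* Let $(X,=_X)$ be a set. The functor $E^X\colon\mathcal P(X)\to\mathbf{Chu}(\mathbf{Set},X)$ defined by $$E^X_0(A,i_A^X)=(A,I_A^X,\mathbf 1),\qquad I_A^X\colon A\times\mathbf 1\to X,\quad I_A^X(a,0)=i_A^X(a)\ \ (a\in A),$$ and, for a morphism $f\colon(A,i_A^X)\to(B,i_B^X)$, $$E^X_1(f)=(f,\mathrm{id}_{\mathbf 1})\colon(A,I_A^X,\mathbf 1)\to(B,I_B^X,\mathbf 1),$$ is a strict Chu representation of $\mathcal P(X)$ into $\mathbf{Chu}(\mathbf{Set},X)$.
   Context: $\mathbf{Set}$ is the category of sets and functions in Bishop's sense (a set $X$ comes with an equality $=_X$, and functions respect equality). $\mathbf 1=\{0\}$ is the one-element set. The category $\mathcal P(X)$ of subsets of $X$ has as objects the subsets of $X$, i.e. pairs $(A,i_A^X)$ with $A$ a set and $i_A^X\colon A\to X$ an injection (embedding); a morphism $(A,i_A^X)\to(B,i_B^X)$ is a function $f\colon A\to B$ with $i_B^X\circ f=i_A^X$. Composition and identities are those of functions. An embedding (of categories) is a functor that is injective on objects and faithful; a representation is a full embedding; a Chu representation is a representation whose codomain is a Chu category; it is strict if it is injective on arrows. Objects of $\mathbf{Chu}(\mathbf{Set},X)$ are triplets $(A,f,B)$ with $A,B$ sets and $f\colon A\times B\to X$; a morphism $(A,f,B)\to(C,g,D)$ is a pair $(\phi^+,\phi^-)$ of functions $\phi^+\colon A\to C$, $\phi^-\colon D\to B$ with $f(a,\phi^-(d))=g(\phi^+(a),d)$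 for all $a\in A$, $d\in D$; $(\theta^+,\theta^-)\circ(\phi^+,\phi^-)=(\theta^+\circ\phi^+,\phi^-\circ\theta^-)$, and identities are $(\mathrm{id}_A,\mathrm{id}_B)$. *)

(* Defs.v *)
From Stdlib Require Import RelationClasses Morphisms.

Set Implicit Arguments.
Unset Strict Implicit.

Record BSet := {
  carrier :> Type;
  beq : carrier -> carrier -> Prop;
  beq_equiv : Equivalence beq
}.

Notation "x ~= y" := (beq x y) (at level 70, no associativity).

#[export] Existing Instance beq_equiv.

Record BFun (A B : BSet) := {
  bfun :> A -> B;
  bfun_proper : Proper (@beq A ==> @beq B) bfun
}.

#[export] Existing Instance bfun_proper.

Program Definition fun_set (A B : BSet) : BSet := {|
  carrier := BFun A B;
  beq := fun f g => forall a : A, f a ~= g a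
|}.
Next Obligation.
  split.
  - intros f a; reflexivity.
  - intros f g H a; symmetry; apply H.
  - intros f g h H K a; transitivity (g a); [apply H | apply K].
Qed.

Program Definition bid (A : BSet) : BFun A A := {| bfun := fun a => a |}.
Next Obligation. intros a a' H; exact H. Qed.

Program Definition bcomp (A B C : BSet) (g : BFun B C) (f : BFun A B) :
  BFun A C := {| bfun := fun a => g (f a) |}.
Next Obligation. intros a a' H; apply bfun_proper, bfun_proper, H. Qed.

Program Definition prod_set (A B : BSet) : BSet := {|
  carrier := A * B;
  beq := fun p q => fst p ~= fst q /\ snd p ~= snd q
|}.
Next Obligation.
  split.
  - intros p; split; reflexivity.
  - intros p q [H K]; split; symmetry; assumption.
  - intros p q r [H K] [H' K']; split; etransitivity; eassumption.
Qed.

Definition one_set : BSet :=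
  {| carrier := unit; beq := @eq unit; beq_equiv := eq_equivalence |}.

Definition binjective (A B : BSet) (f : BFun A B) : Prop :=
  forall a a' : A, f a ~= f a' -> a ~= a'.

(** The arrows between two objects form a Bishop set, so equality of parallel
    arrows is [~=]; objects are compared by the identity [=] of Rocq. *)
Record Category := {
  obj :> Type;
  hom : obj -> obj -> BSet;
  idm : forall a, hom a a;
  comp : forall a b c, hom b c -> hom a b -> hom a c;
  comp_proper : forall a b c,
    Proper (@beq (hom b c) ==> @beq (hom a b) ==> @beq (hom a c)) (@comp a b c);
  comp_idl : forall a b (f : hom a b), comp (idm b) f ~= f;
  comp_idr : forall a b (f : hom a b), comp f (idm a) ~= f;
  comp_assoc : forall a b c d (h : hom c d) (g : hom b c) (f : hom a b),
    comp h (comp g f) ~= comp (comp h g) f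
}.

Record Functor (C D : Category) := {
  fobj :> C -> D;
  fmap : forall a b : C, hom a b -> hom (fobj a) (fobj b);
  fmap_proper : forall a b : C,
    Proper (@beq (hom a b) ==> @beq (hom (fobj a) (fobj b))) (@fmap a b);
  fmap_id : forall a : C, fmap (idm a) ~= idm (fobj a);
  fmap_comp : forall (a b c : C) (g : hom b c) (f : hom a b),
    fmap (comp g f) ~= comp (fmap g) (fmap f)
}.

(** Equality of two arrows with possibly different endpoints: the endpoints
    coincide and, as parallel arrows, the two are equal. *)
Inductive arr_eq (C : Category) (a b : C) (f : hom a b) :
  forall c d : C, hom c d -> Prop :=
| arr_eq_intro (g : hom a b) : f ~= g -> arr_eq f g.

Section FunctorProperties.
Variables (C D : Category) (F : Functor C D).

Definition injective_on_objects : Prop :=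
  forall a b : C, F a = F b -> a = b.

Definition injective_on_arrows : Prop :=
  forall (a b c d : C) (f : hom a b) (g : hom c d),
    arr_eq (fmap F f) (fmap F g) -> arr_eq f g.

Definition faithful : Prop :=
  forall (a b : C) (f g : hom a b), fmap F f ~= fmap F g -> f ~= g.

Definition full : Prop :=
  forall (a b : C) (h : hom (F a) (F b)), exists f : hom a b, fmap F f ~= h.

Definition embedding : Prop := injective_on_objects /\ faithful.

Definition representation : Prop := embedding /\ full.

End FunctorProperties.

Section Subsets.
Variable X : BSet.

Record Subset := {
  sub_set : BSet;
  sub_emb : BFun sub_set X;
  sub_emb_inj : binjective sub_emb
}.

Record SubHom (A B : Subset) := {
  sub_fun :> BFun (sub_set A) (sub_set B);
  sub_fun_comm : forall a : sub_set A, sub_emb B (sub_fun a) ~= sub_emb A a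
}.

Program Definition sub_hom (A B : Subset) : BSet := {|
  carrier := SubHom A B;
  beq := fun f g => @beq (fun_set _ _) (sub_fun f) (sub_fun g)
|}.
Next Obligation.
  split.
  - intros f x; reflexivity.
  - intros f g H x; symmetry; apply H.
  - intros f g h H K x; transitivity (sub_fun g x); [apply H | apply K].
Qed.

Program Definition sub_id (A : Subset) : sub_hom A A :=
  {| sub_fun := bid (sub_set A) |}.
Next Obligation. cbn; reflexivity. Qed.

Program Definition sub_comp (A B C : Subset)
  (g : sub_hom B C) (f : sub_hom A B) : sub_hom A C :=
  {| sub_fun := bcomp (sub_fun g) (sub_fun f) |}.
Next Obligation.
  etransitivity; [apply (sub_fun_comm g) | apply (sub_fun_comm f)].
Qed.

Program Definition PX : Category := {|
  obj := Subset; hom := sub_hom; idm := sub_id; comp := sub_comp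
|}.
Next Obligation.
  intros g g' Hg f f' Hf x; cbn.
  etransitivity; [apply bfun_proper, Hf | apply Hg].
Qed.
Next Obligation. cbn; reflexivity. Qed.
Next Obligation. cbn; reflexivity. Qed.
Next Obligation. cbn; reflexivity. Qed.

End Subsets.

Section Chu.
Variable X : BSet.

Record ChuObj := {
  chu_pos : BSet;
  chu_neg : BSet;
  chu_map : BFun (prod_set chu_pos chu_neg) X
}.

Record ChuHom (P Q : ChuObj) := {
  chu_fwd : BFun (chu_pos P) (chu_pos Q);
  chu_bwd : BFun (chu_neg Q) (chu_neg P);
  chu_adj : forall (a : chu_pos P) (d : chu_neg Q),
    chu_map P (a, chu_bwd d) ~= chu_map Q (chu_fwd a, d)
}.

Program Definition chu_hom (P Q : ChuObj) : BSet := {|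
  carrier := ChuHom P Q;
  beq := fun phi psi =>
    @beq (fun_set _ _) (chu_fwd phi) (chu_fwd psi) /\
    @beq (fun_set _ _) (chu_bwd phi) (chu_bwd psi)
|}.
Next Obligation.
  split.
  - intros f; split; intros x; reflexivity.
  - intros f g [H K]; split; intros x; symmetry; [apply H | apply K].
  - intros f g h [H K] [H' K']; split; intros x;
      [transitivity (chu_fwd g x) | transitivity (chu_bwd g x)]; auto.
Qed.

Program Definition chu_id (P : ChuObj) : chu_hom P P :=
  {| chu_fwd := bid (chu_pos P); chu_bwd := bid (chu_neg P) |}.
Next Obligation. cbn; reflexivity. Qed.

Program Definition chu_comp (P Q S : ChuObj)
  (theta : chu_hom Q S) (phi : chu_hom P Q) : chu_hom P S := {|
  chu_fwd := bcomp (chu_fwd theta) (chu_fwd phi);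
  chu_bwd := bcomp (chu_bwd phi) (chu_bwd theta)
|}.
Next Obligation.
  etransitivity; [apply (chu_adj phi) | apply (chu_adj theta)].
Qed.

Program Definition Chu : Category := {|
  obj := ChuObj; hom := chu_hom; idm := chu_id; comp := chu_comp
|}.
Next Obligation.
  intros g g' [Hg Kg] f f' [Hf Kf]; split; intros x; cbn.
  - etransitivity; [apply bfun_proper, Hf | apply Hg].
  - etransitivity; [apply bfun_proper, Kg | apply Kf].
Qed.
Next Obligation. split; reflexivity. Qed.
Next Obligation. split; reflexivity. Qed.
Next Obligation. split; reflexivity. Qed.

End Chu.

Definition Chu_representation (C : Category) (X : BSet)
  (F : Functor C (Chu X)) : Prop := representation F.

Definition strict_Chu_representation (C : Category) (X : BSet)
  (F : Functor C (Chu X)) : Prop :=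
  Chu_representation F /\ injective_on_arrows F.

Section EX.
Variable X : BSet.

Program Definition EX_map (A : Subset X) :
  BFun (prod_set (sub_set A) one_set) X :=
  {| bfun := fun p => sub_emb A (fst p) |}.
Next Obligation. intros p q [H _]; apply bfun_proper, H. Qed.

Definition EX_obj (A : PX X) : Chu X :=
  {| chu_pos := sub_set A; chu_neg := one_set; chu_map := EX_map A |}.

Program Definition EX_fmap (A B : PX X) (f : hom A B) :
  hom (EX_obj A) (EX_obj B) :=
  {| chu_fwd := sub_fun f; chu_bwd := bid one_set |}.
Next Obligation. symmetry; apply (sub_fun_comm f). Qed.

Program Definition EX : Functor (PX X) (Chu X) :=
  {| fobj := EX_obj; fmap := EX_fmap |}.
Next Obligation. intros f g H; split; [exact H | reflexivity]. Qed.
Next Obligation. split; reflexivity. Qed.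
Next Obligation. split; reflexivity. Qed.

End EX.

(* Main.v *)
Require Import Defs.
From Stdlib Require Import FunctionalExtensionality ProofIrrelevance.

(** An arrow [(A, I_A, 1) -> (B, I_B, 1)] of Chu spaces is a function
    [A -> B] together with a function [1 -> 1].  The second component carries
    no information, and the adjointness equation between the two says exactly
    that the first one commutes with the embeddings into [X].  This gives
    fullness ([EX_full]) and faithfulness ([EX_faithful]).

    The object [(A, I_A, 1)] determines the subset [(A, i_A)], since the values
    of [i_A] are those of [I_A] ([EX_injective_on_objects]).  Objects are
    compared by [=], and subsets carry proofs (of extensionality and of
    injectivity), so this step uses function extensionality and proof
    irrelevance.

    Strictness is then formal: an embedding of categories is injective on
    arrows ([embedding_injective_on_arrows]), because equality of the images
    forces the endpoints to agree, after which faithfulness applies. *)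

Lemma BFun_ext (A B : BSet) (f g : BFun A B) :
  (forall a, f a = g a) -> f = g.
Proof.
  destruct f as [f Hf], g as [g Hg]; cbn; intros E.
  apply functional_extensionality in E; subst g.
  f_equal; apply proof_irrelevance.
Qed.

(** For parallel arrows, the equality of endpoints contained in [arr_eq] is a
    loop; by uniqueness of identity proofs it is trivial. *)
Lemma arr_eq_parallel (C : Category) (a b : C) (f g : hom a b) :
  arr_eq f g -> f ~= g.
Proof.
  assert (K : forall (c d : C) (g : hom c d), arr_eq f g ->
    forall (p : c = a) (q : d = b),
    f ~= eq_rect d (hom a) (eq_rect c (fun z => hom z d) g a p) b q).
  { intros c d k [k' H] p q.
    rewrite (proof_irrelevance _ p eq_refl), (proof_irrelevance _ q eq_refl).
    exact H. }
  intros H; exact (K a b g H eq_refl eq_refl).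
Qed.

Lemma arr_eq_endpoints (C : Category) (a b c d : C)
  (f : hom a b) (g : hom c d) : arr_eq f g -> a = c /\ b = d.
Proof. intros []; split; reflexivity. Qed.

Lemma embedding_injective_on_arrows (C D : Category) (F : Functor C D) :
  embedding F -> injective_on_arrows F.
Proof.
  intros [inj faith] a b c d f g H.
  destruct (arr_eq_endpoints _ _ _ _ _ _ _ H) as [Eac Ebd].
  apply inj in Eac, Ebd; subst c d.
  constructor; apply faith, arr_eq_parallel, H.
Qed.

(** The graph of [i_A] is read off from an arbitrary Chu space [P] as the
    relation [exists n, f (a, n) = x], which makes sense without knowing that
    the second component of [P] is a singleton.  Pairing this relation with the
    first component of [P] gives a function on all Chu spaces, so that an
    equality of images under [EX] can be transported along it. *)
Lemma EX_injective_on_objects (X : BSet) : injective_on_objects (EX X).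
Proof.
  intros [S i Hi] [T j Hj] E.
  apply (f_equal (fun P : ChuObj X =>
    existT (fun S : BSet => S -> X -> Prop) (chu_pos P)
      (fun a x => exists n : chu_neg P, chu_map P (a, n) = x))) in E.
  apply eq_sigT_uncurried_iff in E as [e E]; cbn in e.
  destruct e; cbn in E.
  assert (Eij : i = j).
  { apply BFun_ext; intros a.
    (* The graphs of [i] and [j] agree at the pair [(a, j a)]. *)
    assert (G : exists _ : unit, i a = j a).
    { change ((fun a x => exists _ : unit, i a = x) a (j a)).
      rewrite E; exists tt; reflexivity. }
    destruct G as [_ G]; exact G. }
  subst j; f_equal; apply proof_irrelevance.
Qed.

Lemma EX_faithful (X : BSet) : faithful (EX X).
Proof. intros A B f g [H _]; exact H. Qed.

Lemma EX_full (X : BSet) : full (EX X).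
Proof.
  intros A B h.
  assert (comm : forall a, sub_emb B (chu_fwd h a) ~= sub_emb A a).
  { intros a; symmetry; exact (chu_adj h a tt). }
  exists (Build_SubHom comm).
  split; intros x; cbn.
  - reflexivity.
  - assert (U : forall u v : unit, u = v) by (intros [] []; reflexivity).
    apply U.
Qed.

Theorem proposition6p2 (X : BSet) : strict_Chu_representation (EX X).
Proof.
  assert (emb : embedding (EX X)).
  { split; [apply EX_injective_on_objects | apply EX_faithful]. }
  split.
  - split; [exact emb | apply EX_full].
  - exact (embedding_injective_on_arrows _ _ _ emb).
Qed.
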